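(* Let $(w_n)_{n=0}^\infty$ be positive real numbers with the property that there exist a number $\varepsilon>0$ and positive integers $(N_j)_j$ such that $$W_j:= \sup_{n:\, |n -N_j|\leq \varepsilon N_j } w_n \to 0, \qquad j\to \infty.$$ Then there exists a probability measure $\sigma$ on $\mathbb{T}$ which is supported on a set of Lebesgue measure zero (that is, there is a Borel set $E\subset\mathbb{T}$ of Lebesgue measure zero with $\sigma(\mathbb{T}\setminus E)=0$) and satisfies $$\sum_{n\in\mathbb{Z}} |\widehat{\sigma}(n)|^2 w_{|n|} < \infty.$$
   Context: $\mathbb{T}$ is the unit circle and $\widehat{\sigma}(n)=\int_{\mathbb{T}}\zeta^{-n}\,d\sigma(\zeta)$, $n\in\mathbb{Z}$, denotes the $n$-th Fourier coefficient of $\sigma$. *)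

(* Defs.v *)
From HB Require Import structures.
From mathcomp Require Import all_boot all_order all_algebra.
From mathcomp Require Import all_classical all_reals all_analysis measurable_realfun.
From mathcomp.real_closed Require Import complex.

Set Implicit Arguments.
Unset Strict Implicit.
Unset Printing Implicit Defensive.

Import Order.TTheory GRing.Theory Num.Theory.
Import numFieldNormedType.Exports.

Local Open Scope classical_set_scope.
Local Open Scope ring_scope.
Local Open Scope complex_scope.

(* [R[i]] gets the topology defined by its norm. *)
HB.instance Definition _ (R : realType) :=
  NormedModule.copy R[i] (R[i] : numFieldType)^o.

Definition unit_circle (R : realType) : set R[i] := [set z | `|z| = 1].
Arguments unit_circle R : clear implicits.

(* The unit circle as a type, with the subspace topology and the Borel
   sigma-algebra. *)
Definition torus (R : realType) : Type := set_type (unit_circle R).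
HB.instance Definition _ (R : realType) := Topological.on (torus R).

Fact unit_circle1 (R : realType) : (1 : R[i]) \in unit_circle R.
Proof. by rewrite inE /unit_circle /= normr1. Qed.
HB.instance Definition _ (R : realType) :=
  isPointed.Build (torus R) (exist _ 1 (unit_circle1 R)).
HB.instance Definition _ (R : realType) :=
  Measurable.copy (torus R) (g_sigma_algebraType (@open (torus R))).

Definition cis (R : realType) (t : R) : R[i] := cos t +i* sin t.

Fact cis_unit_circle (R : realType) (t : R) : cis t \in unit_circle R.
Proof. by rewrite inE /unit_circle /= normc_def /= cos2Dsin2 sqrtr1. Qed.

Definition torus_cis (R : realType) (t : R) : torus R :=
  exist _ (cis t) (cis_unit_circle t).

(* Lebesgue (arc length) measure on the circle: the image of Lebesgue measure
   on [0, 2 pi) under t |-> e^(it). *)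
Definition torus_lebesgue (R : realType) : set (torus R) -> \bar R :=
  pushforward
    (mrestr lebesgue_measure (measurable_itv `[(0 : R), 2 * pi[))
    (@torus_cis R).

Lemma cvg_realcomplex (R : realType) : continuous (fun x : R => x%:C : R[i]).
Proof.
move=> x; apply/cvgrPdist_lt => -[a b] /=.
rewrite ltcE /= => /andP[/eqP -> a0].
near=> y; rewrite -rmorphB /= normc_def /= expr0n addr0 sqrtr_sqr ltcR.
by near: y; apply: cvgr_dist_lt.
Unshelve. all: by end_near. Qed.

Lemma continuous_cis (R : realType) : continuous (@cis R).
Proof.
have -> : @cis R = fun t => (cos t)%:C + 'i * (sin t)%:C.
  apply/funext => t; apply/eqP.
  by rewrite eq_complex /= !(mul0r, mul1r, addr0, mulr0, subr0, add0r) !eqxx.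
move=> t; apply: cvgD.
  by apply: continuous_comp; [exact: continuous_cos|exact: cvg_realcomplex].
apply: cvgM; first exact: cvg_cst.
by apply: continuous_comp; [exact: continuous_sin|exact: cvg_realcomplex].
Qed.

Lemma measurable_torus_cis (R : realType) :
  measurable_fun [set: R] (@torus_cis R).
Proof.
have mE : @measurable _ (torus R) = <<s @open (torus R) >> by [].
apply: (measurability (@open (torus R)) mE) => _ [_ [U oU <-] <-].
rewrite setTI; apply: open_measurable.
by have /continuousP := @continuous_cis R; apply.
Qed.

Section torus_lebesgue_measure.
Variable R : realType.
Local Notation m := (@torus_lebesgue R).

Let torus_lebesgue0 : m set0 = 0%E.
Proof. by apply: measure0; exact: measurable_torus_cis. Qed.

Let torus_lebesgue_ge0 A : (0 <= m A)%E.
Proof. by apply: measure_ge0; exact: measurable_torus_cis. Qed.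

Let torus_lebesgue_sigma_additive : semi_sigma_additive m.
Proof.
by apply: measure_semi_sigma_additive; exact: measurable_torus_cis.
Qed.

HB.instance Definition _ := isMeasure.Build _ (torus R) R m
  torus_lebesgue0 torus_lebesgue_ge0 torus_lebesgue_sigma_additive.

End torus_lebesgue_measure.

(* Componentwise integral; it is the usual one when the real and imaginary
   parts of [f] are integrable, as they are for the bounded continuous
   functions below. *)
Definition Cintegral d (T : measurableType d) (R : realType)
    (mu : {measure set T -> \bar R}) (f : T -> R[i]) : R[i] :=
  (\int[mu]_x complex.Re (f x)) +i* (\int[mu]_x complex.Im (f x)).

Definition fourier_coef (R : realType) (sigma : probability (torus R) R)
    (n : int) : R[i] :=
  Cintegral sigma (fun zeta : torus R => (val zeta : R[i]) ^ (- n)).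

(* Main.v *)
Require Import Defs.
From HB Require Import structures.
From mathcomp Require Import all_boot all_order all_algebra.
From mathcomp Require Import zify ring lra.
From mathcomp Require Import all_classical all_reals all_analysis.
From mathcomp Require Import measurable_realfun.
From mathcomp.real_closed Require Import complex.

(** The measure is a Riesz product: the weak limit [sigma] of the probability
    densities [\prod_(j < k) (1 + cos (N j * t)) / (2 * pi)] along a very
    lacunary subsequence [N] of the given frequencies.  Every frequency of the
    [k]-th factor times the previous ones lies either in the spectrum of the
    previous product or within [freq_bound N k = \sum_(j < k) N j] of
    [N k] or [- N k], that is, in the window around [N k] where [w] is as small
    as we like, while the coefficients are at most [1] and their sum is [2 ^ k].
    Hence the weighted sum converges if [w <= 4 ^- k] on the [k]-th window.

    The limit is taken on distribution functions, which converge uniformly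
    because integrating [cos (N k * t)] gains a factor [1 / N k]; [sigma] is the
    resulting Lebesgue-Stieltjes measure, and its Fourier coefficients are
    computed by Stieltjes sums.

    For singularity, the functions [cos (N i * t)] are orthogonal for Lebesgue
    measure, while [cos (N i * t) - 1 / 2] are orthogonal for [sigma].  By
    Chebyshev's inequality their means over [i < 2 ^ l] are close to [0] off a
    set of Lebesgue measure [O(2 ^- l)], and close to [1 / 2] off a set of
    [sigma]-measure [O(2 ^- l)]; Borel-Cantelli concludes. *)

Set Implicit Arguments.
Unset Strict Implicit.
Unset Printing Implicit Defensive.

Import Order.TTheory GRing.Theory Num.Theory.
Import numFieldNormedType.Exports.
Import ComplexField.Normc.

Local Open Scope classical_set_scope.
Local Open Scope ring_scope.

(** * Coefficients of Riesz products *)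

(* [riesz_sum N k h] is [\sum_n a n * h n], where the [a n] are the Fourier
   coefficients of [t |-> \prod_(j < k) (1 + cos (N j * t))]. *)
Fixpoint riesz_sum (R : realType) (N : nat -> nat) (k : nat) (h : int -> R)
    : R :=
  if k is j.+1 then
    riesz_sum N j
      (fun n => h n + (h (n + (N j)%:Z) + h (n - (N j)%:Z)) / 2)
  else h 0.

Definition freq_bound (N : nat -> nat) (k : nat) : nat := (\sum_(j < k) N j)%N.

Lemma freq_boundS N k : freq_bound N k.+1 = (freq_bound N k + N k)%N.
Proof. by rewrite /freq_bound big_ord_recr. Qed.

Lemma leq_freq_bound N j k : (j <= k)%N -> (freq_bound N j <= freq_bound N k)%N.
Proof.
move=> /subnK <-; elim: (k - j)%N => [//|i IH].
by rewrite addSn freq_boundS (leq_trans IH)// leq_addr.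
Qed.

Section riesz_sum.
Context {R : realType} (N : nat -> nat).
Implicit Types (h : int -> R) (k : nat) (c : R).
Local Notation rs := (@riesz_sum R N).
Local Notation B := (freq_bound N).

(** The [a n] are nonnegative and vanish for [|n| > B k]: each step of the recursion adds to [h] the
    average of its shifts by [N j] and [- N j]. *)
Lemma le_riesz_sum k h h' :
  (forall n : int, (`|n| <= B k)%N -> h n <= h' n) -> rs k h <= rs k h'.
Proof.
elim: k h h' => [|k IH] h h' hh' /=; first by apply: hh'.
apply: IH => n nk; rewrite lerD//; first by apply: hh'; rewrite freq_boundS; lia.
rewrite ler_pM2r ?invr_gt0//.
by rewrite lerD//; apply: hh'; rewrite freq_boundS; lia.
Qed.

Lemma eq_riesz_sum k h h' :
  (forall n : int, (`|n| <= B k)%N -> h n = h' n) -> rs k h = rs k h'.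
Proof. by move=> hh'; apply/le_anti/andP; split; apply: le_riesz_sum => n /hh' ->. Qed.

Lemma riesz_sumDl k a h h' :
  rs k (fun n => a * h n + h' n) = a * rs k h + rs k h'.
Proof.
elim: k h h' => [//|k IH] h h' /=; rewrite -IH.
by apply: eq_riesz_sum => n _; field.
Qed.

(** The coefficients add up to the value of the product at [t = 0], where every factor is [2]. *)
Lemma riesz_sum_cst k c : rs k (fun=> c) = c * 2 ^+ k.
Proof.
elim: k c => [|k IH] c /=; first by rewrite mulr1.
by rewrite IH exprS; field.
Qed.

Lemma riesz_sumZ k a h : rs k (fun n => a * h n) = a * rs k h.
Proof.
have := riesz_sumDl k a h (fun=> 0); rewrite riesz_sum_cst mul0r addr0 => <-.
by apply: eq_riesz_sum => n _; rewrite addr0.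
Qed.

Lemma riesz_sumD k h h' : rs k (fun n => h n + h' n) = rs k h + rs k h'.
Proof.
rewrite -[X in X + _]mul1r -riesz_sumDl.
by apply: eq_riesz_sum => n _; rewrite mul1r.
Qed.

Lemma riesz_sumB k h h' : rs k (fun n => h n - h' n) = rs k h - rs k h'.
Proof.
rewrite -mulN1r addrC -riesz_sumDl.
by apply: eq_riesz_sum => n _; rewrite mulN1r addrC.
Qed.

Lemma riesz_sum_sum k (I : Type) (s : seq I) (f : I -> int -> R) :
  rs k (fun n => \sum_(i <- s) f i n) = \sum_(i <- s) rs k (f i).
Proof.
elim: s => [|i s IH].
  rewrite big_nil -[RHS](mul0r (2 ^+ k)) -riesz_sum_cst.
  by apply: eq_riesz_sum => n _; rewrite big_nil.
rewrite big_cons -IH -riesz_sumD.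
by apply: eq_riesz_sum => n _; rewrite big_cons.
Qed.

Lemma riesz_sumS k h : rs k.+1 h = rs k h +
  (rs k (fun n => h (n + (N k)%:Z)) + rs k (fun n => h (n - (N k)%:Z))) / 2.
Proof.
rewrite -riesz_sumD mulrC -riesz_sumZ -riesz_sumD /=.
by apply: eq_riesz_sum => n _; rewrite [2^-1 * _]mulrC.
Qed.

Lemma riesz_sum_opp k h : rs k (fun n => h (- n)) = rs k h.
Proof.
elim: k h => [|k IH] h /=; first by rewrite oppr0.
rewrite -[RHS]IH; apply: eq_riesz_sum => n _.
by rewrite !opprD opprK [h (- n - _) + _]addrC.
Qed.

Lemma riesz_sum_ge0 k h : (forall n, 0 <= h n) -> 0 <= rs k h.
Proof.
by move=> h0; rewrite -(mul0r (2 ^+ k)) -riesz_sum_cst; apply: le_riesz_sum.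
Qed.

Definition riesz_coef k (n : int) : R := rs k (fun m => (m == n)%:R).

Lemma riesz_coefS k n : riesz_coef k.+1 n = riesz_coef k n +
  (riesz_coef k (n - (N k)%:Z) + riesz_coef k (n + (N k)%:Z)) / 2.
Proof.
rewrite /riesz_coef riesz_sumS; congr (_ + (_ + _) / _).
  by apply: eq_riesz_sum => m _; rewrite [in RHS]eq_sym subr_eq [in RHS]eq_sym.
by apply: eq_riesz_sum => m _; rewrite subr_eq.
Qed.

Lemma riesz_coef_ge0 k n : 0 <= riesz_coef k n.
Proof. by apply: riesz_sum_ge0 => m; rewrite ler0n. Qed.

Lemma riesz_coef_opp k n : riesz_coef k (- n) = riesz_coef k n.
Proof.
rewrite /riesz_coef -riesz_sum_opp.
by apply: eq_riesz_sum => m _; rewrite eqr_oppLR opprK.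
Qed.

Lemma riesz_coef_eq0 k (n : int) : (B k < `|n|)%N -> riesz_coef k n = 0.
Proof.
move=> kn; rewrite -(mul0r (2 ^+ k)) -riesz_sum_cst.
apply: eq_riesz_sum => m mk; case: eqVneq => // mn.
by move: mk; rewrite mn leqNgt kn.
Qed.

Hypothesis lacunary : forall k, (2 * B k < N k)%N.

Lemma leq_id_freq_bound k : (k <= B k)%N.
Proof.
elim: k => [//|k IH]; rewrite freq_boundS -addn1 leq_add//.
by have := lacunary k; lia.
Qed.

Lemma ltn_lacunary j k : (j < k)%N -> (N j <= B k)%N.
Proof.
by move=> jk; rewrite (leq_trans _ (leq_freq_bound N jk))// freq_boundS leq_addl.
Qed.

(** By lacunarity the block of radius [B k] around [0] is disjoint from those around [N k] and
    [- N k]. On it the shifted terms vanish; off it only an average of two numbers at most [1]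
    remains. *)
Lemma riesz_coef_le1 k n : riesz_coef k n <= 1.
Proof.
elim: k n => [|k IH] n; first by rewrite /riesz_coef /= lern1 leq_b1.
rewrite riesz_coefS; have [nk|nk] := leqP `|n| (B k).
  have lk := lacunary k.
  rewrite (@riesz_coef_eq0 _ (n - _)); last lia.
  rewrite (@riesz_coef_eq0 _ (n + _)); last lia.
  by rewrite addr0 mul0r addr0.
by rewrite riesz_coef_eq0// add0r ler_pdivrMr// mul1r lerD.
Qed.

(** Later factors only create frequencies outside [[- B k, B k]]. Each coefficient is thus
    eventually constant in [k], and its final value is the Fourier coefficient of the limit
    measure. *)
Lemma riesz_coef_stable k j (n : int) : (`|n| <= B k)%N -> (k <= j)%N ->
  riesz_coef j n = riesz_coef k n.
Proof.
move=> nk /subnK <-; elim: (j - k)%N => [//|i IH].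
rewrite addSn riesz_coefS -{}IH; have lk := lacunary (i + k).
have := leq_freq_bound N (leq_addl i k) => ?.
rewrite (@riesz_coef_eq0 _ (n - _)); last lia.
rewrite (@riesz_coef_eq0 _ (n + _)); last lia.
by rewrite addr0 mul0r addr0.
Qed.

Lemma riesz_coef0 k : riesz_coef k 0 = 1.
Proof. by rewrite (@riesz_coef_stable 0). Qed.

Lemma riesz_coef_gen j k : (j < k)%N -> riesz_coef k (N j)%:Z = 1 / 2.
Proof.
move=> jk; have lj := lacunary j.
rewrite (@riesz_coef_stable j.+1)//; last by rewrite freq_boundS; lia.
rewrite riesz_coefS subrr riesz_coef0 !riesz_coef_eq0; try lia.
by rewrite add0r addr0.
Qed.

(** The value is the square of the coefficient [1 / 2] at a single frequency; this makes the
    functions [cos (N i * t) - 1 / 2] orthogonal for the limit measure. *)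
Lemma riesz_coef_genD i j k : (i < j)%N -> (j < k)%N ->
  riesz_coef k ((N j)%:Z + (N i)%:Z) = 1 / 4 /\
  riesz_coef k ((N j)%:Z - (N i)%:Z) = 1 / 4.
Proof.
move=> ij jk; have lj := lacunary j; have Nij := ltn_lacunary ij.
have iE := riesz_coef_gen ij.
split; (rewrite (@riesz_coef_stable j.+1)//; last by rewrite freq_boundS; lia).
  rewrite riesz_coefS addrAC subrr add0r iE !riesz_coef_eq0; try lia.
  by field.
rewrite riesz_coefS addrAC subrr add0r riesz_coef_opp iE !riesz_coef_eq0; try lia.
by field.
Qed.

(** The blocks added at stage [k] lie in the window of [N k] or its reflection and have total
    coefficient [2 ^ k], so they contribute at most [2 ^ k * 4 ^- k = 2 ^- k]. The bound is [w 0]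
    plus a partial geometric sum. *)
Lemma riesz_sum_weight (w : nat -> R) k :
  (forall k n, (`|n%:Z - (N k)%:Z| <= B k)%N -> w n <= (1 / 4) ^+ k) ->
  rs k (fun n => w `|n|%N) <= w 0 + 2 - 2 * (1 / 2) ^+ k.
Proof.
move=> wN; elim: k => [|k IH]; first by rewrite /= expr0; lra.
rewrite riesz_sumS (le_trans (lerD IH (_ : _ <= (1 / 2) ^+ k)))//; last first.
  by rewrite exprS; lra.
have -> : (1 / 2 : R) ^+ k = (1 / 4) ^+ k * 2 ^+ k.
  by rewrite -exprMn; congr (_ ^+ _); field.
have lk := lacunary k.
rewrite ler_pdivrMr// [_ * 2]mulr_natr mulr2n.
by rewrite -riesz_sum_cst lerD//; apply: le_riesz_sum => n nk; apply: wN; lia.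
Qed.

(** Squares are dominated by the coefficients, which lie in [[0, 1]]; the sum of
    [h n * riesz_coef k n] over [s] is then the pairing with [h] cut off to [s], which is at most
    [h]. *)
Lemma riesz_coef_sum (h : int -> R) k (s : seq int) : uniq s ->
  (forall n, 0 <= h n) ->
  \sum_(n <- s) riesz_coef k n ^+ 2 * h n <= rs k h.
Proof.
move=> us h0; apply: (@le_trans _ _ (\sum_(n <- s) h n * riesz_coef k n)).
  apply: ler_sum => n _; rewrite mulrC ler_wpM2l// expr2.
  by rewrite ler_piMr ?riesz_coef_ge0 ?riesz_coef_le1.
under eq_bigr do rewrite -riesz_sumZ.
rewrite -riesz_sum_sum; apply: le_riesz_sum => n _.
have [ns|ns] := boolP (n \in s).
  rewrite (bigD1_seq n)//= eqxx mulr1 big1 ?addr0// => m mn.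
  by rewrite eq_sym (negbTE mn) mulr0.
rewrite big_seq big1// => m ms; case: eqVneq => [nm|_]; last by rewrite mulr0.
by rewrite nm ms in ns.
Qed.

End riesz_sum.

(** * Primitives of partial Riesz products *)

Section riesz_primitive.
Context {R : realType}.
Implicit Types (phi t c : R) (n m : int).

Lemma is_derive_continuous (f df : R -> R) :
  (forall x : R, is_derive x 1 f (df x)) -> continuous f.
Proof.
move=> fdf x; apply: differentiable_continuous.
by apply/derivable1_diffP; exact: ex_derive.
Qed.

Lemma is_derive_MVT (f df : R -> R) (a b : R) : a <= b ->
  (forall x : R, is_derive x 1 f (df x)) ->
  exists2 x, a <= x <= b & f b - f a = df x * (b - a).
Proof.
move=> ab fdf.
have cf : {within `[a, b], continuous f}.
  exact/continuous_subspaceT/(is_derive_continuous fdf).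
have [y yab ->] := MVT_segment ab (fun x _ => fdf x) cf.
by exists y => //; rewrite in_itv in yab.
Qed.

Lemma is_derive_nincr (f df : R -> R) (a b : R) : a <= b ->
  (forall x : R, is_derive x 1 f (df x)) ->
  (forall x, a <= x <= b -> df x <= 0) -> f b <= f a.
Proof.
move=> ab fdf df0; have [y yab E] := is_derive_MVT ab fdf.
by rewrite -subr_le0 E mulr_le0_ge0 ?subr_ge0// df0.
Qed.

(* The phases [0] and [- pi / 2] give [cos (n * t)] and [sin (n * t)]. *)
Definition cosp phi n t : R := cos (n%:~R * t + phi).

Definition cosp_prim phi n t : R :=
  if n == 0 then t * cos phi else sin (n%:~R * t + phi) / n%:~R.

Lemma is_derive_cosp_prim phi n t :
  is_derive t 1 (cosp_prim phi n) (cosp phi n t).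
Proof.
rewrite /cosp_prim /cosp; case: eqVneq => [->|n0].
  rewrite mul0r add0r; apply: is_derive_eq.
  by rewrite scaler0 add0r; exact: mulr1.
have n0' : n%:~R != 0 :> R by rewrite intr_eq0.
have d : is_derive t 1 (fun t : R => n%:~R * t + phi) n%:~R.
  by apply: is_derive_eq; rewrite addr0; exact: mulr1.
have d' := @is_derive1_comp R (@sin R) (fun t => n%:~R * t + phi) t _ _
  (is_derive_sin (n%:~R * t + phi)) d.
have d2 := is_deriveM d' (is_derive_cst (n%:~R^-1 : R) t 1).
apply: is_derive_eq.
by rewrite scaler0 add0r /GRing.scale/= mulrCA mulVf// mulr1.
Qed.

Lemma cosp_primE phi n : cosp_prim phi n (2 * pi) - cosp_prim phi n 0 =
  2 * pi * cos phi * (n == 0)%:R.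
Proof.
rewrite /cosp_prim; case: eqVneq => [_|n0].
  by rewrite mul0r subr0 mulr1.
rewrite mulr0 mulr0 add0r.
suff -> : sin (n%:~R * (2 * pi) + phi) = sin phi by rewrite subrr.
have per := periodicn (@sinD2pi R).
case: n n0 => n _.
  by rewrite addrC (mulr_natl pi) mulr_natl per.
rewrite NegzE mulrNz mulNr addrC -(per n.+1).
by rewrite (mulr_natl pi) mulr_natl subrK.
Qed.

Lemma norm_cosp_prim phi n t : n != 0 -> `|cosp_prim phi n t| <= `|n|%N%:R^-1.
Proof.
move=> n0; rewrite /cosp_prim (negbTE n0) normrM normfV.
by rewrite -intr_norm natr_absz ler_piMl ?sin_max// invr_ge0 ler0z.
Qed.

Lemma is_derive_cosp phi n t :
  is_derive t 1 (cosp phi n) (- sin (n%:~R * t + phi) * n%:~R).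
Proof.
have d : is_derive t 1 (fun t : R => n%:~R * t + phi) n%:~R.
  by apply: is_derive_eq; rewrite addr0; exact: mulr1.
exact: (@is_derive1_comp R (@cos R) (fun t => n%:~R * t + phi) t _ _
  (is_derive_cos (n%:~R * t + phi)) d).
Qed.

Lemma measurable_cosp phi n : measurable_fun setT (cosp phi n).
Proof.
apply: continuous_measurable_fun.
exact: (is_derive_continuous (is_derive_cosp phi n)).
Qed.

Lemma cosp_lipschitz phi n s t : `|cosp phi n t - cosp phi n s| <= `|n%:~R| * `|t - s|.
Proof.
wlog st : s t / s <= t.
  by move=> W; have /orP[/W//|/W] := le_total s t; rewrite distrC [`|s - t|]distrC.
have [x _ ->] := is_derive_MVT st (is_derive_cosp phi n).
by rewrite !normrM ler_wpM2r// normrN ler_piMl// sin_max.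
Qed.

Lemma is_derive_avg (f g : R -> R) (df dg t : R) :
  is_derive t 1 f df -> is_derive t 1 g dg ->
  is_derive t 1 (fun t => (f t + g t) / 2) ((df + dg) / 2).
Proof.
move=> fdf gdg; have := is_deriveZ (2^-1 : R) (is_deriveD fdf gdg).
by rewrite /GRing.scale/= mulrC; under eq_fun do rewrite mulrC.
Qed.

Variable N : nat -> nat.
Local Notation rs := (@riesz_sum R N).

Lemma is_derive_riesz_sum k (p : int -> R -> R) (dp : int -> R) t :
  (forall n, is_derive t 1 (p n) (dp n)) ->
  is_derive t 1 (fun t => rs k (p^~ t)) (rs k dp).
Proof.
elim: k p dp => [|k IH] p dp pdp /=; first exact: pdp.
apply: (IH (fun n t => p n t + (p (n + (N k)%:Z) t + p (n - (N k)%:Z) t) / 2)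
  (fun n => dp n + (dp (n + (N k)%:Z) + dp (n - (N k)%:Z)) / 2)) => n.
exact: is_deriveD (pdp n) (is_derive_avg (pdp _) (pdp _)).
Qed.

Definition riesz_density k t : R := rs k (cosp 0 ^~ t).

(** At [h n = cos (n * t)] the recursion step is, by the product-to-sum formula, multiplication by
    the nonnegative factor [1 + cos (N k * t)]. *)
Lemma riesz_density_ge0 k t : 0 <= riesz_density k t.
Proof.
rewrite /riesz_density; elim: k => [|k IH] /=.
  by rewrite /cosp mul0r addr0 cos0.
rewrite (@eq_riesz_sum _ _ _ _ (fun n => (1 + cos ((N k)%:R * t)) * cosp 0 n t)).
  by rewrite riesz_sumZ mulr_ge0// -lerBlDl sub0r cos_geN1.
move=> n _; rewrite /cosp !addr0 !intrD mulrNz !mulrDl mulNr cosD cosB /=.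
by rewrite -pmulrn; field.
Qed.

(* A primitive of [cosp phi m] times the [k]-th partial product, by
   linearization of [cos (m * t + phi) * cos (n * t)]. *)
Definition riesz_primitive phi m k t : R :=
  rs k (fun n => (cosp_prim phi (m + n) t + cosp_prim phi (m - n) t) / 2).

Definition riesz_cdf k t : R := rs k (cosp_prim 0 ^~ t).

Lemma riesz_primitiveE phi m k :
  riesz_primitive phi m k (2 * pi) - riesz_primitive phi m k 0 =
  2 * pi * cos phi * riesz_coef N k m.
Proof.
(* Over a full period only the modes [n = - m] and [n = m] survive, each with weight [1 / 2];
   evenness of the coefficients merges them. *)
have -> : riesz_coef N k m = (riesz_coef N k (- m) + riesz_coef N k m) / 2 :> R.
  by rewrite riesz_coef_opp; field.
rewrite mulrA mulrAC /riesz_primitive /riesz_coef -riesz_sumB -riesz_sumD -riesz_sumZ.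
apply: eq_riesz_sum => n _.
rewrite -mulrBl opprD addrACA !cosp_primE.
by rewrite subr_eq0 [m == n]eq_sym [m + n]addrC addr_eq0; field.
Qed.

Lemma is_derive_riesz_primitive phi m k t :
  is_derive t 1 (riesz_primitive phi m k) (cosp phi m t * riesz_density k t).
Proof.
have -> : cosp phi m t * riesz_density k t =
    riesz_sum N k (fun n => (cosp phi (m + n) t + cosp phi (m - n) t) / 2).
  rewrite -riesz_sumZ; apply: eq_riesz_sum => n _.
  rewrite /cosp addr0 !intrD mulrNz !mulrDl mulNr.
  rewrite ![_ + _ + phi]addrAC.
  by move: (m%:~R * t + phi) (n%:~R * t) => a b; rewrite cosD cosB; field.

apply: (is_derive_riesz_sum k (p := fun n t =>
  (cosp_prim phi (m + n) t + cosp_prim phi (m - n) t) / 2)) => n.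
by apply: is_derive_avg; apply: is_derive_cosp_prim.
Qed.

Lemma is_derive_riesz_cdf k t : is_derive t 1 (riesz_cdf k) (riesz_density k t).
Proof. by apply: is_derive_riesz_sum => n; apply: is_derive_cosp_prim. Qed.

Lemma riesz_cdf_ndecr k s t : s <= t -> riesz_cdf k s <= riesz_cdf k t.
Proof.
move=> st; have [x _ E] := is_derive_MVT st (is_derive_riesz_cdf k).
by rewrite -subr_ge0 E mulr_ge0 ?riesz_density_ge0 ?subr_ge0.
Qed.

(* Both [H - (g s + C) * F] and [(g s - C) * F - H] have nonpositive derivative
   on [[s, t]]. *)
Lemma riesz_primitive_local phi m k s t : s <= t ->
  `|riesz_primitive phi m k t - riesz_primitive phi m k s -
    cosp phi m s * (riesz_cdf k t - riesz_cdf k s)| <=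
  `|m%:~R| * (t - s) * (riesz_cdf k t - riesz_cdf k s).
Proof.
move=> st; set H := riesz_primitive phi m k; set F := riesz_cdf k.
set g := cosp phi m; set C := `|m%:~R| * (t - s).
have gC x : s <= x <= t -> `|g x - g s| <= C.
  move=> /andP[sx xt]; rewrite (le_trans (cosp_lipschitz _ _ _ _))//.
  by rewrite ler_wpM2l// ger0_norm ?subr_ge0// lerB.
have dZ (a x : R) : is_derive x 1 (fun x => a * F x) (a * riesz_density k x).
  exact: (is_deriveZ (a : R) (is_derive_riesz_cdf k x)).
have d1 (x : R) := is_deriveB (is_derive_riesz_primitive phi m k x) (dZ (g s + C) x).
have d2 (x : R) := is_deriveB (dZ (g s - C) x) (is_derive_riesz_primitive phi m k x).
have := is_derive_nincr st d1; have := is_derive_nincr st d2.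
rewrite /= -/g -/H ler_norml => h1 h2.
have {}h1 : (g s - C) * F t - H t <= (g s - C) * F s - H s.
  apply: h1 => x /gC; rewrite ler_norml => /andP[h _].
  rewrite -mulrBl mulr_le0_ge0 ?riesz_density_ge0//; lra.
have {}h2 : H t - (g s + C) * F t <= H s - (g s + C) * F s.
  apply: h2 => x /gC; rewrite ler_norml => /andP[_ h].
  rewrite -mulrBl mulr_le0_ge0 ?riesz_density_ge0//; lra.
by apply/andP; split; lra.
Qed.

End riesz_primitive.

(** * Stieltjes sums *)

Section riemann_stieltjes.
Context {R : realType}.

Definition stieltjes_sum (a b : R) (g F : R -> R) (n : nat) : R :=
  \sum_(i < n) g (a + i%:R * ((b - a) / n%:R)) *
    (F (a + i.+1%:R * ((b - a) / n%:R)) - F (a + i%:R * ((b - a) / n%:R))).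

Lemma stieltjes_sum_approx (a b C : R) (H F g : R -> R) (n : nat) :
  a <= b -> (0 < n)%N ->
  (forall s t, a <= s -> s <= t -> t <= b ->
    `|H t - H s - g s * (F t - F s)| <= C * (t - s) * (F t - F s)) ->
  `|H b - H a - stieltjes_sum a b g F n| <= C * ((b - a) / n%:R) * (F b - F a).
Proof.
move=> ab n0 loc; pose x i : R := a + i%:R * ((b - a) / n%:R).
have n0' : 0 < n%:R :> R by rewrite ltr0n.
have tel (f : R -> R) : f b - f a = \sum_(i < n) (f (x i.+1) - f (x i)).
  rewrite -(big_mkord xpredT (fun i => f (x i.+1) - f (x i))).
  rewrite (telescope_sumr (f \o x))//=; congr (f _ - f _).
    by rewrite /x; field; rewrite gt_eqF.
  by rewrite /x mul0r addr0.
rewrite (tel H) (tel F) -sumrB mulr_sumr (le_trans (ler_norm_sum _ _ _))//.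
have d0 : 0 <= (b - a) / n%:R by rewrite divr_ge0 ?subr_ge0// ltW.
apply: ler_sum => i _.
have -> : C * ((b - a) / n%:R) = C * (x i.+1 - x i).
  by rewrite /x -natr1; ring.
apply: loc; rewrite /x.
  by rewrite lerDl mulr_ge0.
  by rewrite lerD2l ler_wpM2r// ler_nat.
rewrite -lerBrDl mulrA ler_pdivrMr// [leRHS]mulrC ler_wpM2r ?subr_ge0//.
by rewrite ler_nat.
Qed.

(* Both [t |-> \int[mu]_(x in `]a, t]) g x] and the [Hk k] satisfy the local
   estimate of [stieltjes_sum_approx], so that the integral and [L] are both
   within [O(1 / n)] of the [n]-th Stieltjes sum of [g] against [F]. *)
Lemma Rintegral_stieltjes (mu : {measure set (measurableTypeR R) -> \bar R}) (F : R -> R)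
    (a b C M L : R) (g : R -> R) (Fk Hk : nat -> R -> R) :
  a <= b ->
  (forall s t, s <= t -> mu `]s, t]%classic = (F t - F s)%:E) ->
  measurable_fun setT g -> (forall x, `|g x| <= M) ->
  (forall s t, `|g t - g s| <= C * `|t - s|) ->
  (forall k s t, s <= t -> `|Hk k t - Hk k s - g s * (Fk k t - Fk k s)|
     <= C * (t - s) * (Fk k t - Fk k s)) ->
  (forall t, Fk ^~ t @ \oo --> F t) ->
  (fun k => Hk k b - Hk k a) @ \oo --> L ->
  \int[mu]_(x in `]a, b]) g x = L.
Proof.
move=> ab muF mg gM gC loc FkF HkL.
have gint s t : s <= t -> mu.-integrable `]s, t]%classic (EFin \o g).
  move=> st; apply: measurable_bounded_integrable => //.
  - by rewrite muF// ltry.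
  - exact: measurable_funTS.
  - by exists M; split; [exact: num_real|move=> x Mx y _ /=; rewrite (le_trans (gM y))// ltW].
pose G t : R := \int[mu]_(x in `]a, t]) g x.
have cint s t (c : R) : s <= t -> mu.-integrable `]s, t]%classic (EFin \o cst c).
  move=> st; apply: measurable_bounded_integrable => //.
  - by rewrite muF// ltry.
  - by exists `|c|; split; [exact: num_real|move=> x cx y _ /=; rewrite ltW].
have C0 : 0 <= C.
  by have := gC 0 1; rewrite subr0 normr1 mulr1; apply: le_trans.
have Gloc s t : a <= s -> s <= t -> t <= b ->
    `|G t - G s - g s * (F t - F s)| <= C * (t - s) * (F t - F s).
  move=> as_ st tb.
  have tU : `]a, t]%classic = `]a, s]%classic `|` `]s, t]%classic :> set R.
    by rewrite -itv_bndbnd_setU// bnd_simp.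
  have -> : G t - G s = \int[mu]_(x in `]s, t]) g x.
    rewrite /G tU Rintegral_setU//; first by rewrite addrC addKr.
      by rewrite -tU; apply: gint; exact: le_trans st.
    apply/disj_setPS => x [] /=; rewrite !in_itv /= => /andP[_ xs] /andP[].
    by rewrite ltNge xs.
  have cE c : \int[mu]_(x in `]s, t]) c = c * (F t - F s).
    by rewrite Rintegral_cst// muF.
  rewrite -!cE -RintegralB//; [|exact: gint|exact: cint].
  have gcint : mu.-integrable `]s, t]%classic (EFin \o (fun x => g x - g s)).
    have mst : measurable (`]s, t]%classic : set (measurableTypeR R)).
      exact: measurable_itv.
    by have := integrableB mst (gint _ _ st) (cint _ _ (g s) st).
  rewrite (le_trans (le_normr_Rintegral _ _))//.
  apply: le_Rintegral => //; [|exact: cint|].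
    by have := integrable_norm gcint.
  move=> x /=; rewrite in_itv/= => /andP[sx xt].
  rewrite (le_trans (gC _ _))// ger0_norm ?subr_ge0 ?(ltW sx)//.
  by rewrite ler_wpM2l// lerB.
have G0 : G a = 0 by rewrite /G set_itvoc0 Rintegral_set0.
have approx n : (0 < n)%N ->
    `|G b - L| <= 2 * (C * (b - a) * (F b - F a)) / n%:R.
  move=> n0; have Sk : stieltjes_sum a b g (Fk k) n @[k --> \oo] -->
      stieltjes_sum a b g F n.
    apply: cvg_big => [|i _]; first exact: add_continuous.
    by apply: cvgMl_tmp; apply: cvgB; exact: FkF.
  have LS : `|L - stieltjes_sum a b g F n| <= C * ((b - a) / n%:R) * (F b - F a).
    apply: (@ler_cvg_to _ \oo _ _
      (fun k => `|Hk k b - Hk k a - stieltjes_sum a b g (Fk k) n|)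
      (fun k => C * ((b - a) / n%:R) * (Fk k b - Fk k a))).
    - by apply: cvg_norm; apply: cvgB.
    - by apply: cvgMl_tmp; apply: cvgB; exact: FkF.
    - by apply: nearW => k; apply: stieltjes_sum_approx => // s t _ st _; exact: loc.
  have := stieltjes_sum_approx ab n0 Gloc; rewrite G0 subr0 => GS.
  have := le_trans (ler_distD (stieltjes_sum a b g F n) (G b) L) _.
  apply; rewrite [X in _ + X]distrC (le_trans (lerD GS LS))//.
  by rewrite le_eqVlt; apply/orP; left; apply/eqP; field; rewrite pnatr_eq0 -lt0n.
apply/eqP; rewrite -subr_eq0 -normr_le0 leNgt -/(G b); apply/negP => GL.
set K := 2 * _ in approx.
(* An [n] beyond [K / |G b - L|] contradicts the bound [K / n]. *)
have := approx (Num.truncn (K / `|G b - L|)).+1 isT.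
rewrite ler_pdivlMr ?ltr0n// leNgt => /negP; apply.
by rewrite mulrC -ltr_pdivrMr// truncnS_gt.
Qed.

End riemann_stieltjes.

(** * The limit measure on the line *)

(** The increments from [k] on sum to at most [4 * (1 / 2) ^+ k]. Subtracting or adding this tail
    turns [u] into a nondecreasing or a nonincreasing sequence, and the two enclose the limit. *)
Lemma geometric_cauchy_cvg (R : realType) (u : nat -> R) :
  (forall k, `|u k.+1 - u k| <= 2 * (1 / 2) ^+ k) ->
  exists2 l : R, u @ \oo --> l & forall k, `|l - u k| <= 4 * (1 / 2) ^+ k.
Proof.
move=> uS; pose v k := u k - 4 * (1 / 2) ^+ k; pose w k := u k + 4 * (1 / 2) ^+ k.
have half k : (1 / 2 : R) ^+ k.+1 = (1 / 2) ^+ k / 2 by rewrite exprSr mul1r.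
have half0 k : 0 <= (1 / 2 : R) ^+ k by rewrite exprn_ge0.
have vnd : nondecreasing_seq v.
  apply/nondecreasing_seqP => k; have := uS k; rewrite ler_norml => /andP[h _].
  by rewrite /v half; lra.
have wni : nonincreasing_seq w.
  apply/nonincreasing_seqP => k; have := uS k; rewrite ler_norml => /andP[_ h].
  by rewrite /w half; lra.
have vw k j : v k <= w j.
  apply: (@le_trans _ _ (v (maxn k j))); first exact/vnd/leq_maxl.
  apply: (@le_trans _ _ (w (maxn k j))); last exact/wni/leq_maxr.
  by rewrite /v /w lerD2l ge0_cp// mulr_ge0.
have vcvg : cvgn v.
  by apply: nondecreasing_is_cvgn => //; exists (w 0) => _ [k _ <-]; exact: vw.
exists (limn v).
  rewrite (_ : u = v + (fun k => 4 * (1 / 2) ^+ k)); last first.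
    by apply/funext => k; rewrite /v /= fctE subrK.
  rewrite -[X in _ --> X]addr0; apply: cvgD => //.
  by rewrite -(mulr0 4); apply: cvgMl_tmp; apply: cvg_expr; rewrite ger0_norm; lra.
move=> k; have h1 : v k <= limn v by exact: nondecreasing_cvgn_le.
have h2 : limn v <= w k by apply: limr_le => //; apply: nearW => j; exact: vw.
by rewrite ler_norml; move: h1 h2; rewrite /v /w => h1 h2; apply/andP; split; lra.
Qed.

Lemma lebesgue_stieltjes_measure_itvoc (R : realType) (f : cumulative R R)
    (s t : R) : s <= t ->
  lebesgue_stieltjes_measure f (`]s, t] : set R)%classic = (f t - f s)%:E.
Proof.
move=> st; rewrite /lebesgue_stieltjes_measure/= /measure_extension/=.
by rewrite measurable_mu_extE/= ?wlength_itv_bnd//; exact: is_ocitv.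
Qed.

Section riesz_measure.
Context {R : realType} (N : nat -> nat).
Local Notation B := (freq_bound N).
Hypothesis lacunary : forall k, (2 * B k < N k)%N.
Hypothesis growth : forall k, (4 ^ k <= N k)%N.

(** The new frequencies [n + N k] and [n - N k], with [|n| <= B k], have size at least [N k / 2], so
    their primitives are at most [2 / N k]. The coefficients total [2 ^ k], and [4 ^ k <= N k]
    leaves a geometric bound uniform in [t]. *)
Lemma riesz_cdfS k t :
  `|riesz_cdf N k.+1 t - riesz_cdf N k t| <= 2 * (1 / 2) ^+ k :> R.
Proof.
have lk := lacunary k; have N0 : 0 < (N k)%:R :> R by rewrite ltr0n; lia.
rewrite /riesz_cdf riesz_sumS addrC addKr.
have bnd (s : int -> int) : (forall n : int, (`|n| <= B k)%N -> (N k <= 2 * `|s n|)%N) ->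
    `|riesz_sum N k (fun n => cosp_prim 0 (s n) t)| <= 2 * (1 / 2) ^+ k :> R.
  move=> sN; have h n : (`|n| <= B k)%N -> `|cosp_prim 0 (s n) t| <= 2 / (N k)%:R :> R.
    move=> /sN Nn; have sn0 : s n != 0 by lia.
    rewrite (le_trans (norm_cosp_prim _ _ sn0))// ler_pdivlMr//.
    by rewrite mulrC ler_pdivrMr ?ltr0n; [rewrite -natrM ler_nat|lia].
  have N4 : 2 / (N k)%:R * 2 ^+ k <= 2 * (1 / 2) ^+ k :> R.
    rewrite -mulrA ler_wpM2l// mulrC ler_pdivrMr//.
    have -> : 2 ^+ k = (1 / 2) ^+ k * 4 ^+ k :> R.
      by rewrite -exprMn; congr (_ ^+ _); field.
    by rewrite ler_wpM2l ?exprn_ge0// -natrX ler_nat.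
  rewrite (le_trans _ N4)// ler_norml -mulNr -!(riesz_sum_cst N).
  apply/andP; split; apply: le_riesz_sum => n /h; rewrite ler_norml => /andP[]//.
rewrite normrM [X in _ * X]ger0_norm// ler_pdivrMr// [_ * 2]mulr_natr mulr2n.
rewrite (le_trans (ler_normD _ _))// lerD//.
  by apply: (bnd (fun n => n + (N k)%:Z)) => n; lia.
by apply: (bnd (fun n => n - (N k)%:Z)) => n; lia.
Qed.

(** Monotonicity passes to the pointwise limit; continuity follows from the uniform error
    [4 * (1 / 2) ^+ k] by an [e / 3] argument. *)
Lemma riesz_cdf_cvg : exists F : R -> R,
  [/\ {homo F : s t / s <= t}, continuous F &
      forall t, riesz_cdf N ^~ t @ \oo --> F t].
Proof.
have /choice[F FE] : forall t : R, exists l : R, riesz_cdf N ^~ t @ \oo --> l /\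
    forall k, `|l - riesz_cdf N k t| <= 4 * (1 / 2) ^+ k.
  move=> t; have [l] := geometric_cauchy_cvg (riesz_cdfS ^~ t).
  by exists l.
exists F; split; last by move=> t; case: (FE t).
  move=> s t st; apply: (@ler_cvg_to _ \oo _ _ (riesz_cdf N ^~ s) (riesz_cdf N ^~ t)).
  - by case: (FE s).
  - by case: (FE t).
  - by apply: nearW => k; exact: riesz_cdf_ndecr.
move=> t; apply/cvgrPdist_le => e e0.
have [k ke] : exists k, 4 * (1 / 2) ^+ k <= e / 3 :> R.
  have : (fun k => 4 * (1 / 2) ^+ k : R) @ \oo --> (0 : R).
    rewrite -(mulr0 4); apply: cvgMl_tmp; apply: cvg_expr; rewrite ger0_norm; lra.
  move=> /cvgrPdist_le /(_ (e / 3)) []; first by lra.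
  move=> k _ /(_ k (leqnn k)); rewrite sub0r normrN => h.
  by exists k; rewrite (le_trans (ler_norm _)).
have : riesz_cdf N k @ t --> riesz_cdf N k t.
  exact: (is_derive_continuous (is_derive_riesz_cdf N k)).
move=> /cvgrPdist_le /(_ (e / 3)) []; first by lra.
move=> d d0 dP; exists d => // s /dP /= ts.
have [_ /(_ k) h1] := FE t; have [_ /(_ k) h2] := FE s.
have := le_trans h1 ke; have := le_trans h2 ke; move: ts; rewrite !ler_norml.
by move=> /andP[? ?] /andP[? ?] /andP[? ?]; apply/andP; split; lra.
Qed.

Lemma riesz_measure_ex : exists mu : {measure set (measurableTypeR R) -> \bar R},
  mu `]0, 2 * pi]%classic = 1%E /\
  forall phi m, \int[mu]_(x in `]0%R, 2 * pi]) cosp phi m x =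
    cos phi * riesz_coef N `|m| m.
Proof.
have [F [Fnd Fc FkF]] := riesz_cdf_cvg.
have pi0 : 0 < 2 * pi :> R by rewrite mulr_gt0// pi_gt0.
have pi0' := ltW pi0.
pose G t := (2 * pi)^-1 * F t.
have Gnd : {homo G : s t / s <= t}.
  by move=> s t st; rewrite /G ler_wpM2l ?invr_ge0// Fnd.
have Gc : right_continuous G.
  by apply: right_continuousW => t; apply: cvgMl_tmp; exact: Fc.
pose Gm := isCumulative.Build R _ R G Gnd Gc.
pose Gcum : cumulative R R := HB.pack G Gm.
pose mu : {measure set (measurableTypeR R) -> \bar R} := lebesgue_stieltjes_measure Gcum.
have muE s t : s <= t -> mu `]s, t]%classic = (G t - G s)%:E.
  exact: (lebesgue_stieltjes_measure_itvoc Gcum).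
have intE phi m : \int[mu]_(x in `]0%R, 2 * pi]) cosp phi m x =
    cos phi * riesz_coef N `|m| m.
  apply: (@Rintegral_stieltjes _ mu G _ _ `|m%:~R| 1 _ _
    (fun k t => (2 * pi)^-1 * riesz_cdf N k t)
    (fun k t => (2 * pi)^-1 * riesz_primitive N phi m k t)) => //.
  - exact: measurable_cosp.
  - by move=> x; exact: cos_max.
  - by move=> s t; exact: cosp_lipschitz.
  - move=> k s t st; rewrite -!mulrBr mulrCA -mulrBr normrM ger0_norm ?invr_ge0//.
    by rewrite mulrCA ler_wpM2l ?invr_ge0//; exact: riesz_primitive_local.
  - by move=> t; apply: cvgMl_tmp; exact: FkF.
  (* The sequence is constant from [k = |m|] on, because [|m| <= B |m|]; hence the rank [|m|] in the
     statement. *)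
  - apply: cvg_near_cst; exists `|m|%N => // k /= mk.
    rewrite -mulrBr riesz_primitiveE (riesz_coef_stable lacunary _ mk).
      by rewrite -!(mulrA (2 * pi)) mulKf// gt_eqF.
    exact: leq_id_freq_bound.
exists mu; split=> //; rewrite muE//; congr EFin.
have := intE 0 0; rewrite cos0 mul1r absz0 riesz_coef0//.
rewrite /cosp; under eq_Rintegral do rewrite mul0r addr0 cos0.
by rewrite Rintegral_cst// muE// mul1r.
Qed.

End riesz_measure.

(** * Weak law for orthogonal functions *)

Section weak_law.
Context {d} {T : measurableType d} {R : realType}.
Variable nu : {measure set T -> \bar R}.
Hypothesis nu_fin : (nu setT < +oo)%E.

Definition bounded_measurable (f : T -> R) :=
  measurable_fun setT f /\ exists M, forall x, `|f x| <= M.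

Lemma bounded_measurable_cst (c : R) : bounded_measurable (fun=> c).
Proof. by split=> //; exists `|c|. Qed.

Lemma bounded_measurableD f g : bounded_measurable f -> bounded_measurable g ->
  bounded_measurable (fun x => f x + g x).
Proof.
move=> [mf [a fa]] [mg [b gb]]; split; first exact: measurable_funD.
by exists (a + b) => x; rewrite (le_trans (ler_normD _ _))// lerD.
Qed.

Lemma bounded_measurableM f g : bounded_measurable f -> bounded_measurable g ->
  bounded_measurable (fun x => f x * g x).
Proof.
move=> [mf [a fa]] [mg [b gb]]; split; first exact: measurable_funM.
by exists (a * b) => x; rewrite normrM ler_pM.
Qed.

Lemma bounded_measurable_sum n (Y : nat -> T -> R) :
  (forall i, bounded_measurable (Y i)) ->
  bounded_measurable (fun x => \sum_(i < n) Y i x).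
Proof.
move=> bY; elim: n => [|n IH].
  by under eq_fun do rewrite big_ord0; exact: bounded_measurable_cst.
by under eq_fun do rewrite big_ord_recr/=; exact: bounded_measurableD.
Qed.

Lemma bounded_measurable_integrable f :
  bounded_measurable f -> nu.-integrable setT (EFin \o f).
Proof.
move=> [mf [a fa]]; apply: measurable_bounded_integrable => //.
exists a; split; [exact: num_real|move=> x ax y _ /=].
by rewrite (le_trans (fa y))// ltW.
Qed.

Lemma Rintegral_lin (a b : R) f g : bounded_measurable f -> bounded_measurable g ->
  \int[nu]_x (a * f x + b * g x) = a * \int[nu]_x f x + b * \int[nu]_x g x.
Proof.
move=> bf bg; have bc c := bounded_measurable_cst c.
rewrite RintegralD//; last 2 first.
- exact/bounded_measurable_integrable/bounded_measurableM.
- exact/bounded_measurable_integrable/bounded_measurableM.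
by rewrite !RintegralZl//; exact: bounded_measurable_integrable.
Qed.

Variables (Y : nat -> T -> R) (M : R).
Hypothesis mY : forall i, measurable_fun setT (Y i).
Hypothesis YM : forall i x, `|Y i x| <= M.
Hypothesis Yorth : forall i j, (i < j)%N -> \int[nu]_x (Y i x * Y j x) = 0.

Let K := fine (nu setT).

Let bY i : bounded_measurable (Y i).
Proof. by split=> //; exists M. Qed.

Let bS n := bounded_measurable_sum n bY.

(** Pythagoras: the cross terms integrate to [0], and each of the [n] squares to at most
    [M ^+ 2 * K]. *)
Lemma orthogonal_sum_sqr n :
  \int[nu]_x (\sum_(i < n) Y i x) ^+ 2 <= n%:R * (M ^+ 2 * K).
Proof.
have orthS k j : (k <= j)%N -> \int[nu]_x ((\sum_(i < k) Y i x) * Y j x) = 0.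
  elim: k => [|k IH] kj.
    under eq_Rintegral do rewrite big_ord0 mul0r.
    by rewrite Rintegral_cst// mul0r.
  under eq_Rintegral do rewrite big_ord_recr/= mulrDl -[X in X + _]mul1r -[X in _ + X]mul1r.
  rewrite (Rintegral_lin _ _ (bounded_measurableM (bS k) (bY j))
    (bounded_measurableM (bY k) (bY j))).
  by rewrite IH ?(ltnW kj)// Yorth// !mulr0 addr0.
elim: n => [|n IH].
  under eq_Rintegral do rewrite big_ord0 expr0n/=.
  by rewrite Rintegral_cst// !mul0r.
have b2 f : bounded_measurable f -> bounded_measurable (fun x => f x ^+ 2).
  by move=> bf; under eq_fun do rewrite expr2; exact: bounded_measurableM.
have bc (c : R) := bounded_measurable_cst c.
have bSY := bounded_measurableM (bS n) (bY n).
have bSYY := bounded_measurableD (bounded_measurableM (bc 2) bSY)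
  (bounded_measurableM (bc 1) (b2 _ (bY n))).
have sqrE x : (\sum_(i < n.+1) Y i x) ^+ 2 = 1 * (\sum_(i < n) Y i x) ^+ 2 +
    1 * (2 * ((\sum_(i < n) Y i x) * Y n x) + 1 * Y n x ^+ 2).
  by rewrite big_ord_recr/=; ring.
under eq_Rintegral do rewrite sqrE.
rewrite (Rintegral_lin _ _ (b2 _ (bS n)) bSYY) (Rintegral_lin _ _ bSY (b2 _ (bY n))).
rewrite orthS// mulr0 add0r !mul1r -natr1 mulrDl mul1r lerD//.
rewrite -Rintegral_cst//; apply: le_Rintegral => //.
- exact/bounded_measurable_integrable/(b2 _ (bY n)).
- exact/bounded_measurable_integrable/bounded_measurable_cst.
- by move=> x _; rewrite -[leLHS]ger0_norm ?sqr_ge0// normrX lerXn2r// nnegrE (le_trans _ (YM 0 x)).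
Qed.

(** Chebyshev for the squared sum at level [(n / 4) ^+ 2]: the constant is [n * M ^+ 2 * K] divided
    by [n ^+ 2 / 16]. *)
Lemma orthogonal_sum_chebyshev n : (0 < n)%N ->
  (nu [set x | (n%:R / 4 <= `|\sum_(i < n) Y i x|)%R] <=
   (16 * (M ^+ 2 * K) / n%:R)%:E)%E.
Proof.
move=> n0; have n0' : 0 < n%:R :> R by rewrite ltr0n.
pose S x := (\sum_(i < n) Y i x) ^+ 2; pose a : R := (n%:R / 4) ^+ 2.
have a0 : 0 < a by rewrite exprn_gt0// divr_gt0.
have bSn : bounded_measurable S.
  by rewrite /S; under eq_fun do rewrite expr2; exact: bounded_measurableM.
have mS : measurable_fun setT (EFin \o S) by apply/measurable_EFinP; case: bSn.
have iS := bounded_measurable_integrable bSn.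
have := @le_integral_comp_abse _ _ _ nu setT measurableT (EFin \o S) a id
  (@measurable_id _ _ _) (fun r h => h) (fun x y _ _ h => h) mS a0.
have -> : setT `&` [set x | (a%:E <= `|(EFin \o S) x|)%E] =
    [set x | (n%:R / 4 <= `|\sum_(i < n) Y i x|)%R].
  rewrite setTI; apply/seteqP; split=> x /=; rewrite lee_fin /a /S normrX;
    by rewrite ler_pXn2r// nnegrE// divr_ge0// ltW.
under eq_integral do rewrite /= ger0_norm ?sqr_ge0//.
rewrite -[X in (_ <= X)%E -> _]fineK; last exact: (integrable_fin_num _ iS).
rewrite -lee_pdivlMl// => /le_trans; apply; rewrite -EFinM lee_fin.
rewrite mulrC ler_pdivrMr// (le_trans (orthogonal_sum_sqr n))//.
rewrite le_eqVlt /a; apply/orP; left; apply/eqP; field.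
by rewrite gt_eqF.
Qed.

End weak_law.

Lemma lim_sup_set_geometric d (T : measurableType d) (R : realType)
    (mu : {measure set T -> \bar R}) (F : nat -> set T) (K : R) :
  (forall i, measurable (F i)) ->
  (forall i, (mu (F i) <= (K / (2 ^ i)%:R)%:E)%E) -> mu (lim_sup_set F) = 0%E.
Proof.
move=> mF muF; apply: lim_sup_set_cvg0 => //.
have K0 : 0 <= K.
  have := le_trans (measure_ge0 mu (F 0%N)) (muF 0%N).
  by rewrite expn0 divr1 lee_fin.
apply: (@le_lt_trans _ _ (2 * K)%:E); last exact: ltry.
(* The terms [e / 2 ^ i.+1] sum to at most [e]; taking [e = 2 * K] absorbs the shifted exponent. *)
apply: le_trans (epsilon_trick0 xpredT _); last by rewrite mulr_ge0.
apply: lee_nneseries => // i _; rewrite (le_trans (muF i))// lee_fin.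
by rewrite expnS natrM invfM mulrACA divff// mul1r.
Qed.

Lemma Rintegral_mrestr d (T : measurableType d) (R : realType)
    (mu : {measure set T -> \bar R}) (D : set T) (mD : measurable D) (f : T -> R) :
  (mu D < +oo)%E -> bounded_measurable f ->
  \int[mrestr mu mD]_x f x = \int[mu]_(x in D) f x.
Proof.
move=> muD bf; have mC := measurableC mD.
have nuT : (mrestr mu mD setT < +oo)%E by rewrite /mrestr setTI.
have := bounded_measurable_integrable nuT bf; rewrite -(setUv D) => intf.
rewrite Rintegral_setU//; last exact/disj_setPCl.
rewrite [X in _ + X](_ : _ = 0) ?addr0.
  rewrite /Rintegral; congr fine; apply: eq_measure_integral => A mA AD.
  by rewrite /= /mrestr setIidl.
rewrite /Rintegral null_set_integral//.
- by apply/measurable_EFinP/measurable_funTS; case: bf.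
-
  by rewrite /= /mrestr setICl measure0.
Qed.

(** * Chebyshev's inequality for lacunary cosine sums *)

Section cosine_law.
Context {R : realType} (N : nat -> nat) (nu : {measure set (measurableTypeR R) -> \bar R}).
Hypothesis nu_fin : (nu setT < +oo)%E.

Lemma bounded_measurable_cosp phi m :
  bounded_measurable (cosp phi m : measurableTypeR R -> R).
Proof. by split; [exact: measurable_cosp|exists 1 => x; exact: cos_max]. Qed.

Variables (c : R).
Hypothesis c01 : 0 <= c <= 1.
Hypothesis nu1 : forall i, \int[nu]_x cosp 0 (N i)%:Z x = c * fine (nu setT).
Hypothesis nuD : forall i j, (i < j)%N ->
  \int[nu]_x cosp 0 ((N j)%:Z + (N i)%:Z) x = c ^+ 2 * fine (nu setT).
Hypothesis nuB : forall i j, (i < j)%N ->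
  \int[nu]_x cosp 0 ((N j)%:Z - (N i)%:Z) x = c ^+ 2 * fine (nu setT).

(** Applied with [c = 0] to Lebesgue measure and [c = 1 / 2] to the Riesz measure. Product-to-sum
    reduces the cross terms to the hypotheses, leaving [c ^+ 2 - 2 * c ^+ 2 + c ^+ 2 = 0]; the terms
    are bounded by [2], whence [64 = 16 * 2 ^+ 2]. *)
Lemma cosp_sum_chebyshev n : (0 < n)%N ->
  (nu [set x | (n%:R / 4 <= `|\sum_(i < n) (cosp 0 (N i)%:Z x - c)|)%R] <=
   (64 * fine (nu setT) / n%:R)%:E)%E.
Proof.
move=> n0; have -> : 64 * fine (nu setT) = 16 * (2 ^+ 2 * fine (nu setT)) by ring.
have bX := bounded_measurable_cosp.
apply: (orthogonal_sum_chebyshev nu_fin (Y := fun i x => cosp 0 (N i)%:Z x - c)) => //.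
- by move=> i; apply: measurable_funB => //; case: (bX 0 (N i)%:Z).
- move=> i x; rewrite (le_trans (ler_normB _ _))// [leRHS](_ : _ = 1 + 1)// lerD//.
    exact: cos_max.
  by case/andP: c01 => c0 c1; rewrite ger0_norm.
move=> i j ij.
have prodE x : (cosp 0 (N i)%:Z x - c) * (cosp 0 (N j)%:Z x - c) =
   1 * (2^-1 * cosp 0 ((N j)%:Z + (N i)%:Z) x + 2^-1 * cosp 0 ((N j)%:Z - (N i)%:Z) x) +
   1 * (- c * (1 * cosp 0 (N i)%:Z x + 1 * cosp 0 (N j)%:Z x) + 1 * c ^+ 2).
  rewrite /cosp !addr0 !intrD mulrNz !mulrDl !mulNr cosD cosB.
  by field.
under eq_Rintegral do rewrite prodE.
have bc (a : R) := @bounded_measurable_cst _ (measurableTypeR R) R a.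
have bL a b f g := bounded_measurableD
  (bounded_measurableM (bc a) f) (bounded_measurableM (bc b) g).
rewrite (Rintegral_lin nu_fin _ _ (bL _ _ _ _ (bX _ _) (bX _ _))
  (bL _ _ _ _ (bL _ _ _ _ (bX _ _) (bX _ _)) (bc _))).
rewrite (Rintegral_lin nu_fin _ _ (bX _ _) (bX _ _)).
rewrite (Rintegral_lin nu_fin _ _ (bL _ _ _ _ (bX _ _) (bX _ _)) (bc _)).
rewrite (Rintegral_lin nu_fin _ _ (bX _ _) (bX _ _)).
by rewrite Rintegral_cst// nuD// nuB// !nu1; field.
Qed.

End cosine_law.

(** * Choice of the frequencies *)

Section choice_of_frequencies.
Context {R : realType}.
Variables (w : nat -> R) (eps : R) (P : nat -> nat).
Hypothesis w_gt0 : forall n, 0 < w n.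
Hypothesis eps_gt0 : 0 < eps.
Hypothesis w_small : (fun j => sup [set w n | n in
  [set n : nat | `|n%:R - (P j)%:R| <= eps * (P j)%:R]]) @ \oo --> (0 : R).

(* [w] has a positive lower bound on [0, M], so windows on which it is small
   are centred beyond [M]. *)
Lemma window_choice (M : nat) (delta : R) : 0 < delta ->
  exists2 n : nat, (M < n)%N &
    forall m : nat, `|m%:R - n%:R| <= eps * n%:R -> w m <= delta.
Proof.
move=> d0.
have [d' d'0 wd'] : exists2 d', 0 < d' & forall m, (m <= M)%N -> d' <= w m.
  elim: M => [|k [d' d'0 wd']]; first by exists (w 0) => // m; rewrite leqn0 => /eqP ->.
  exists (Num.min d' (w k.+1)); first by rewrite lt_min d'0 w_gt0.
  move=> m; rewrite leq_eqVlt => /predU1P[->|/wd' h]; first by rewrite ge_min lexx orbT.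
  by rewrite ge_min h.
have [j _ /(_ j (leqnn j))/=] : \forall j \near \oo, `|0 - sup [set w n | n in
    [set n : nat | `|n%:R - (P j)%:R| <= eps * (P j)%:R]]| < Num.min delta d'.
  by move/cvgrPdist_lt : w_small; apply; rewrite lt_min d0.
set A := [set w n | n in _]; rewrite sub0r normrN => /(le_lt_trans (ler_norm _)).
rewrite lt_min => /andP[Ad Ad'].
(* [sup A] dominates [A] only if [A] is bounded above. The window holds finitely many integers, so
   the sum of the positive [w i] up to its right end is an upper bound. *)
have Aub : has_ubound A.
  exists (\sum_(i < (P j + Num.truncn (eps * (P j)%:R)).+1) w i) => _ [m /= mP <-].
  have mle : (m < (P j + Num.truncn (eps * (P j)%:R)).+1)%N.
    rewrite ltnS -leq_subLR truncn_ge_nat ?mulr_ge0 ?(ltW eps_gt0)//.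
    have [mPj|/ltnW Pjm] := leqP m (P j).
      by rewrite (eqP mPj) mulr_ge0 ?(ltW eps_gt0).
    by rewrite natrB// (le_trans (ler_norm _)).
  rewrite (bigD1 (Ordinal mle))//= lerDl sumr_ge0// => i _; exact: ltW.
have wA m : `|m%:R - (P j)%:R| <= eps * (P j)%:R -> w m <= sup A.
  by move=> mP; apply: ub_le_sup => //; exists m.
exists (P j); last by move=> m /wA h; rewrite (le_trans h)// ltW.
rewrite ltnNge; apply/negP => /wd'; rewrite leNgt => /negP; apply.
by rewrite (le_lt_trans (wA _ _)) ?subrr ?normr0 ?mulr_ge0// ltW.
Qed.

(** Each frequency is chosen after the previous ones with [B k <= eps * N k], so that all integers
    within [B k] of [N k] lie in the window where [w] is small. *)
Lemma frequency_choice : exists N : nat -> nat,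
  [/\ forall k, (2 * freq_bound N k < N k)%N, forall k, (4 ^ k <= N k)%N &
   forall k n, (`|n%:Z - (N k)%:Z| <= freq_bound N k)%N -> w n <= (1 / 4) ^+ k].
Proof.
have /choice[f fP] : forall kS : nat * nat, exists n, [/\ (2 * kS.2 < n)%N,
    (4 ^ kS.1 <= n)%N, kS.2%:R <= eps * n%:R &
    forall m, `|m%:R - n%:R| <= eps * n%:R -> w m <= (1 / 4) ^+ kS.1].
  move=> [k S]/=.
  have q0 : 0 < (1 / 4 : R) ^+ k by rewrite exprn_gt0.
  (* The summands secure, in order, [2 * S < n], [4 ^ k <= n] and [S <= eps * n]. *)
  have [n Mn nP] := window_choice (2 * S + 4 ^ k + Num.truncn (S%:R / eps)) q0.
  exists n; split=> //; [lia|lia|].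
  rewrite mulrC -ler_pdivrMr// (le_trans (ltW (truncnS_gt _)))// ler_nat.
  by rewrite (leq_ltn_trans _ Mn)// leq_addl.
(* The next choice depends on the earlier frequencies only through their sum, which [st]
   accumulates. *)
pose st := fix st k := if k is j.+1 then (st j + f (j, st j))%N else 0%N.
exists (fun k => f (k, st k)).
have BE k : freq_bound (fun k => f (k, st k)) k = st k.
  by elim: k => [|k IH]; [rewrite /freq_bound big_ord0|rewrite freq_boundS IH].
split=> k; rewrite ?BE.
- by case: (fP (k, st k)).
- by case: (fP (k, st k)).
move=> n; have [/= _ _ h fw] := fP (k, st k) => nk.
apply: fw; rewrite (le_trans _ h)// !pmulrn -intrB -intr_norm.
by rewrite -natr_absz !pmulrn ler_int.
Qed.

End choice_of_frequencies.

(** * Integer powers on the circle and their measurability *)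

Section torus_functions.
Context {R : realType}.

Lemma cisXz (t : R) (m : int) : cis t ^ m = cis (m%:~R * t).
Proof.
have cis0 : cis 0 = 1 :> R[i] by rewrite /cis cos0 sin0.
have cisD (s u : R) : cis (s + u) = cis s * cis u.
  by apply/eqP; rewrite eq_complex /= cosD sinD [cos s * sin u + _]addrC !eqxx.
have cis_neq0 (s : R) : cis s != 0.
  apply/eqP => s0; have := cisD s (- s).
  by rewrite subrr cis0 s0 mul0r => /eqP; rewrite oner_eq0.
have cisX n : cis t ^+ n = cis (n%:R * t).
  elim: n => [|n IH]; first by rewrite mul0r cis0.
  by rewrite exprSr IH -cisD -natr1 mulrDl mul1r.
case: m => n; first by rewrite -exprnP cisX.
rewrite NegzE -exprnN cisX mulrNz mulNr.
apply: (mulfI (cis_neq0 (n.+1%:R * t))).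
by rewrite -cisD subrr cis0 mulfV.
Qed.

Lemma continuous_Re : continuous (@complex.Re R : R[i] -> R).
Proof.
move=> z; have FF : Filter (nbhs z) by exact: nbhs_filter.
have := (@cvgrPdist_lt _ _ _ _ FF (@complex.Re R) (complex.Re z)).2; apply => e e0.
apply/nbhs_ballP; exists e%:C%C; first by rewrite /= ltcR.
move=> y; rewrite /ball /= normc_def ltcR; apply: le_lt_trans.
rewrite -sqrtr_sqr ler_wsqrtr// raddfB/= lerDl sqr_ge0//.
Qed.

(** The factor [c], taken as [1], [-i] or [i], yields the real part, the imaginary part and its
    opposite from one continuity argument. *)
Lemma measurable_torus_Re (c : R[i]) (n : nat) :
  measurable_fun setT (fun z : torus R => complex.Re (c * val z ^+ n)).
Proof.
have mE : @measurable _ (torus R) = <<s @open (torus R) >> by [].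
have cRe : continuous (fun z : torus R => complex.Re (c * val z ^+ n)).
  have cval : continuous (fun z : torus R => val z : R[i]).
    exact: initial_continuous.
  have cX k : continuous (fun x : R[i] => x ^+ k).
    elim: k => [|k IH] x; have FF : Filter (nbhs x) by exact: nbhs_filter.
      exact: (@cvg_cst _ (1 : R[i]) _ (nbhs x) FF).
    rewrite /continuous_at exprS; under eq_fun do rewrite exprS.
    exact: (@cvgM _ _ (nbhs x) FF id (fun y => y ^+ k) _ _ cvg_id (IH x)).
  have cM : continuous (fun x : R[i] => c * x ^+ n).
    move=> x; have FF : Filter (nbhs x) by exact: nbhs_filter.
    exact: (@cvgM _ _ (nbhs x) FF (fun=> c) (fun y => y ^+ n) _ _
      (@cvg_cst _ c _ (nbhs x) FF) (cX n x)).
  by move=> z; exact: (continuous_comp (cval z)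
    (continuous_comp (cM (val z)) (@continuous_Re (c * val z ^+ n)))).
apply: (measurability _ (RGenOInfty.measurableE R)).
move=> _ [_ [a ->] <-]; rewrite setTI; apply: sub_sigma_algebra.
by move/continuousP : cRe; apply; exact: interval_open.
Qed.

(** On the unit circle the inverse is the conjugate, which reduces negative exponents to positive
    ones. *)
Lemma invc_norm1 (x : R[i]) : `|x| = 1 ->
  complex.Re x^-1 = complex.Re x /\ complex.Im x^-1 = - complex.Im x.
Proof.
case: x => a b; rewrite normc_def /= => -[/(congr1 (fun x => x ^+ 2))].
by rewrite sqr_sqrtr ?addr_ge0 ?sqr_ge0// expr1n => ->; rewrite !divr1.
Qed.

Lemma measurable_torus_exprz (m : int) :
  measurable_fun setT (fun z : torus R => complex.Re ((val z : R[i]) ^ m)) /\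
  measurable_fun setT (fun z : torus R => complex.Im ((val z : R[i]) ^ m)).
Proof.
have ReE (x : R[i]) : complex.Re x = complex.Re (1 * x) by rewrite mul1r.
have ImE (x : R[i]) : complex.Im x = complex.Re ((0 -i* 1)%C * x).
  by case: x => a b /=; rewrite mul0r sub0r mulN1r opprK.
have NImE (x : R[i]) : - complex.Im x = complex.Re ((0 +i* 1)%C * x).
  by case: x => a b /=; rewrite mul0r sub0r mul1r.
case: m => n.
  split.
    by under eq_fun do rewrite ReE; exact: measurable_torus_Re.
  by under eq_fun do rewrite ImE; exact: measurable_torus_Re.
have nz (z : torus R) : `|(val z : R[i]) ^+ n.+1| = 1.
  have := valP z; rewrite inE /unit_circle /= => z1.
  by rewrite normrX z1 expr1n.
split.
  under eq_fun do rewrite NegzE -exprnN (invc_norm1 (nz _)).1 ReE.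
  exact: measurable_torus_Re.
under eq_fun do rewrite NegzE -exprnN (invc_norm1 (nz _)).2 NImE.
exact: measurable_torus_Re.
Qed.

End torus_functions.

(** * Cosine sums under the Riesz measure and under Lebesgue measure *)

Section riesz_torus.
Context {R : realType} (N : nat -> nat).
Hypothesis lacunary : forall k, (2 * freq_bound N k < N k)%N.
Hypothesis growth : forall k, (4 ^ k <= N k)%N.

Lemma riesz_probability : exists P : probability (measurableTypeR R) R,
  forall phi m, \int[P]_x cosp phi m x = cos phi * riesz_coef N `|m| m.
Proof.
have [mu [mu1 muE]] := riesz_measure_ex (R := R) lacunary growth.
have mD : measurable (`]0, 2 * pi]%classic : set (measurableTypeR R)).
  exact: measurable_itv.
have nuT : mrestr mu mD setT = 1%E by rewrite /mrestr setTI.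
pose P : probability (measurableTypeR R) R :=
  HB.pack (mrestr mu mD) (Measure_isProbability.Build _ _ R (mrestr mu mD) nuT).
exists P => phi m; rewrite -muE.
apply: Rintegral_mrestr; last exact: bounded_measurable_cosp.
by rewrite mu1 ltry.
Qed.

(* The empty Riesz product is the density of Lebesgue measure. *)
Lemma lebesgue_cosp phi m :
  \int[@lebesgue_measure R]_(x in `]0%R, 2 * pi]) cosp phi m x =
  2 * pi * cos phi * riesz_coef N 0 m.
Proof.
have cdf0 t : riesz_cdf N 0 t = t :> R.
  by rewrite /riesz_cdf /= /cosp_prim eqxx cos0 mulr1.
have pi0 : 0 <= 2 * pi :> R by rewrite mulr_ge0// pi_ge0.
rewrite -riesz_primitiveE.
apply: (@Rintegral_stieltjes _ _ idfun _ _ `|m%:~R| 1 _ _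
  (fun k t => riesz_cdf N 0 t) (fun k t => riesz_primitive N phi m 0 t)) => //.
- by move=> s t; exact: lebesgue_stieltjes_measure_itvoc.
- exact: measurable_cosp.
- by move=> x; exact: cos_max.
- by move=> s t; exact: cosp_lipschitz.
- by move=> _ s t; exact: riesz_primitive_local.
- by move=> t; rewrite cdf0; exact: cvg_cst.
- exact: cvg_cst.
Qed.

Lemma measurable_preimage_lt d (T : measurableType d) (f : T -> R) (c : R) :
  measurable_fun setT f -> measurable [set x | f x < c].
Proof.
move=> mf; have := mf measurableT `]-oo, c[%classic (measurable_itv _).
by rewrite setTI; congr (measurable _); apply/seteqP; split=> x /=; rewrite in_itv.
Qed.

Lemma measurable_preimage_ge d (T : measurableType d) (f : T -> R) (c : R) :
  measurable_fun setT f -> measurable [set x | c <= f x].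
Proof.
move=> mf; have := mf measurableT `[c, +oo[%classic (measurable_itv _).
by rewrite setTI; congr (measurable _); apply/seteqP; split=> x /=; rewrite in_itv/= andbT.
Qed.

Lemma measurable_cosp_sum (n : nat) (c : R) :
  measurable_fun setT (fun x : measurableTypeR R => \sum_(i < n) (cosp 0 (N i)%:Z x - c)).
Proof.
apply: (bounded_measurable_sum n (Y := fun i x => cosp 0 (N i)%:Z x - c) _).1 => i.
apply: bounded_measurableD; first exact: bounded_measurable_cosp.
exact: bounded_measurable_cst.
Qed.

Lemma cosp_sumB0 n : (fun x : R => \sum_(i < n) cosp 0 (N i)%:Z x) =
  (fun x => \sum_(i < n) (cosp 0 (N i)%:Z x - 0)).
Proof. by apply/funext => x; apply: eq_bigr => i _; rewrite subr0. Qed.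

(** A sum of cosines below [n / 4] makes the sum of the centred terms [cos (N i * t) - 1 / 2] fall
    below [- n / 4]. *)
Lemma cosp_sum_half (P : probability (measurableTypeR R) R) :
  (forall phi m, \int[P]_x cosp phi m x = cos phi * riesz_coef N `|m| m) ->
  forall n, (0 < n)%N ->
  (P [set x | (\sum_(i < n) cosp 0 (N i)%:Z x < n%:R / 4)%R] <= (64 / n%:R)%:E)%E.
Proof.
move=> PE n n0; have n0' : 0 < n%:R :> R by rewrite ltr0n.
have PT : fine (P setT) = 1 by rewrite probability_setT.
(* The coefficient at [N i] is read at rank [N i], which must exceed [i] for it to have its final
   value [1 / 2]. *)
have N_gt i : (i < N i)%N.
  by have := lacunary i; have := leq_id_freq_bound lacunary i; lia.
have Pfin : (P setT < +oo)%E by rewrite probability_setT ltry.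
have := @cosp_sum_chebyshev R N P Pfin (1 / 2) _ _ _ _ n n0.
rewrite PT mulr1 => H; apply: (le_trans _ (H _ _ _ _)).
- apply: le_measure; rewrite ?inE.
  + apply: measurable_preimage_lt; rewrite cosp_sumB0.
    exact: measurable_cosp_sum.
  + apply: measurable_preimage_ge; apply: measurableT_comp => //.
    exact: measurable_cosp_sum.
  move=> x /=; rewrite sumrB sumr_const card_ord -mulr_natr => xn.
  by rewrite -normrN (le_trans _ (ler_norm _))//; lra.
- by apply/andP; split; lra.
- by move=> i; rewrite PE cos0 mul1r mulr1 riesz_coef_gen.
- move=> i j ij; rewrite PE cos0 mul1r mulr1 (riesz_coef_genD _ ij _).1//.
    by field.
  by have := N_gt j; lia.
- move=> i j ij; rewrite PE cos0 mul1r mulr1 (riesz_coef_genD _ ij _).2//.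
    by field.
  have := lacunary j; have := ltn_lacunary N ij; have := leq_id_freq_bound lacunary j.
  lia.
Qed.

Lemma cosp_sum_lebesgue n : (0 < n)%N ->
  (lebesgue_measure ([set x : measurableTypeR R |
    (n%:R / 4 <= \sum_(i < n) cosp 0 (N i)%:Z x)%R] `&`
      [set` `[0%R, (2 * pi)%R[]) <= (64 * (2 * pi) / n%:R)%:E)%E.
Proof.
move=> n0; have n0' : 0 < n%:R :> R by rewrite ltr0n.
have mD : measurable (`]0, 2 * pi]%classic : set (measurableTypeR R)).
  exact: measurable_itv.
have DE : lebesgue_measure (`]0, 2 * pi]%classic : set R) = (2 * pi)%:E.
  by rewrite lebesgue_measure_itv/= lte_fin mulr_gt0 ?pi_gt0// oppr0 adde0.
have Dfin : (lebesgue_measure (`]0%R, (2 * pi)%R]%classic : set R) < +oo)%E.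
  by rewrite DE ltry.
pose nu : {measure set (measurableTypeR R) -> \bar R} := mrestr lebesgue_measure mD.
have nuT : nu [set: measurableTypeR R] = (2 * pi)%:E by rewrite /nu /= /mrestr setTI.
have nuE m : \int[nu]_x cosp 0 m x = 2 * pi * (0 == m)%:R.
  rewrite Rintegral_mrestr; [|exact: Dfin|exact: bounded_measurable_cosp].
  by rewrite lebesgue_cosp cos0 mulr1.
have nufin : (nu [set: measurableTypeR R] < +oo)%E by rewrite nuT ltry.
have Nneq0 j (m : int) : (`|m| <= freq_bound N j)%N -> (0 == (N j)%:Z + m) = false.
  by have := lacunary j; lia.
have := @cosp_sum_chebyshev R N nu nufin 0 _ _ _ _ n n0.
rewrite nuT /= mul0r expr0n mul0r => H.
set A := [set x : measurableTypeR R | _].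
have mA : measurable A.
  apply: measurable_preimage_ge; rewrite cosp_sumB0; exact: measurable_cosp_sum.
have {}H : (nu A <= (64 * (2 * pi) / n%:R)%:E)%E.
  apply: (le_trans _ (H _ _ _ _)).
  - apply: le_measure; rewrite ?inE//.
      apply: measurable_preimage_ge; apply: measurableT_comp => //.
      exact: measurable_cosp_sum.
    move=> x; rewrite /A /= => xA; under eq_bigr do rewrite subr0.
    exact: le_trans xA (ler_norm _).
  - by rewrite lexx ler01.
  - by move=> i; rewrite nuE -[(N i)%:Z]addr0 Nneq0// mulr0.
  - move=> i j ij; rewrite nuE Nneq0 ?mulr0//; exact: ltn_lacunary.
  - move=> i j ij; rewrite nuE Nneq0 ?mulr0// abszN; exact: ltn_lacunary.
have mAD : measurable (A `&` `]0%R, (2 * pi)%R]%classic).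
  by apply: measurableI => //; exact: measurable_itv.
have m0 : measurable ([set 0%R] : set (measurableTypeR R)).
  exact: measurable_set1.
(* Arc length is taken on [[0, 2 * pi[] but the Stieltjes integrals on []0, 2 * pi]]; adjoining the
   null set [{0}] bridges the two. *)
apply: (le_trans _ H); apply: (@le_trans _ _ (lebesgue_measure
    ((A `&` `]0%R, (2 * pi)%R]%classic) `|` [set 0%R]))).
  apply: le_measure; rewrite ?inE.
  - by apply: measurableI => //; exact: measurable_itv.
  - exact: measurableU.
  move=> x [Ax] /=; rewrite !in_itv /= => /andP[x0 x2].
  move: x0; rewrite le_eqVlt => /predU1P[<-|x0]; first by right.
  by left; split=> //; apply/andP; split=> //; exact: ltW.
apply: (le_trans (measureU2 lebesgue_measure mAD m0)).
rewrite -[leRHS]adde0; apply: leeD => //; by have /= -> := @lebesgue_measure_set1 R 0.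
Qed.

End riesz_torus.

(** * Transfer to the circle *)

Section riesz_torus_measure.
Context {R : realType} (N : nat -> nat).
Hypothesis lacunary : forall k, (2 * freq_bound N k < N k)%N.
Hypothesis growth : forall k, (4 ^ k <= N k)%N.

Lemma torus_cis_Re (x : R) (m : int) :
  complex.Re ((val (torus_cis x) : R[i]) ^ m) = cosp 0 m x.
Proof. by rewrite /= cisXz /cosp addr0. Qed.

Lemma torus_cis_Im (x : R) (m : int) :
  complex.Im ((val (torus_cis x) : R[i]) ^ m) = cosp (- (pi / 2)) m x.
Proof. by rewrite /= cisXz /cosp cosBpihalf. Qed.

Lemma riesz_torus_probability : exists sigma : probability (torus R) R,
  (forall n, fourier_coef sigma n = (riesz_coef N `|n| n)%:C%C) /\
  exists E : set (torus R),
    [/\ measurable E, torus_lebesgue E = 0%E & sigma (~` E) = 0%E].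
Proof.
have [P PE] := riesz_probability (R := R) lacunary growth.
have Pfin : (P [set: measurableTypeR R] < +oo)%E.
  by rewrite probability_setT ltry.
have mcis : measurable_fun [set: measurableTypeR R] (@torus_cis R).
  exact: measurable_torus_cis.
pose X : {mfun measurableTypeR R >-> torus R} :=
  HB.pack (@torus_cis R) (isMeasurableFun.Build _ _ _ _ _ mcis).
have PXE (f : torus R -> R) phi m : measurable_fun setT f ->
    (forall x, f (torus_cis x) = cosp phi m x) ->
    \int[distribution P X]_z f z = cos phi * riesz_coef N `|m| m.
  move=> mf fE; rewrite -PE /Rintegral integral_distribution.
  - by congr fine; apply: eq_integral => x _ /=; rewrite fE.
  - exact/measurable_EFinP.
  rewrite (_ : _ \o _ = EFin \o cosp phi m); last first.
    by apply/funext => x /=; rewrite fE.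
  by apply: bounded_measurable_integrable; last exact: bounded_measurable_cosp.
exists (distribution P X); split.
  move=> n; rewrite /fourier_coef /Cintegral.
  (* The real and imaginary parts have phases [0] and [- pi / 2]. The factor [cos (- pi / 2) = 0]
     removes the latter, and evenness of the coefficients turns [- n] into [n]. *)
  rewrite (PXE _ 0 (- n)) ?(PXE _ (- (pi / 2)) (- n)).
  - by rewrite cos0 cosN cos_pihalf mul0r mul1r abszN riesz_coef_opp.
  - exact: (measurable_torus_exprz _).2.
  - by move=> x; rewrite torus_cis_Im.
  - exact: (measurable_torus_exprz _).1.
  - by move=> x; rewrite torus_cis_Re.
pose S n (z : torus R) := \sum_(i < n) complex.Re ((val z : R[i]) ^ (N i)%:Z).
(* The threshold [1 / 4] separates the means [0] and [1 / 2], and the sample sizes [2 ^ i] make the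
   [O(1 / n)] bounds summable. *)
pose A i : set (torus R) := [set z | (2 ^ i)%:R / 4 <= S (2 ^ i)%N z].
have SE n x : S n (torus_cis x) = \sum_(i < n) cosp 0 (N i)%:Z x.
  by apply: eq_bigr => i _; rewrite torus_cis_Re.
have mA i : measurable (A i).
  apply: measurable_preimage_ge; apply: measurable_sum => j.
  exact: (measurable_torus_exprz _).1.
exists (lim_sup_set A); split.
- apply: bigcap_measurable => // k _; exact: bigcup_measurable.
- apply: (@lim_sup_set_geometric _ _ _ _ _ (64 * (2 * pi))) => // i.
  have := cosp_sum_lebesgue lacunary (R := R) (expn_gt0 2 i : (0 < 2 ^ i)%N = true).
  rewrite (_ : [set x | _] = (@torus_cis R) @^-1` A i) //.
  by apply/seteqP; split=> x; rewrite /A /= SE.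
(* A point outside the limsup of the [A i] is eventually in every complement, hence in infinitely
   many. *)
apply: (@subset_measure0 _ _ _ (distribution P X) _ (lim_sup_set (fun i => ~` A i))).
- apply: measurableC; apply: bigcap_measurable => // k _.
  exact: bigcup_measurable.
- apply: bigcap_measurable => // k _; apply: bigcup_measurable => i _.
  exact: measurableC.
- move=> x /existsNP[n /not_implyP[_ nA]] m _.
  exists (maxn m n); first exact: leq_maxl.
  by move=> Ax; apply: nA; exists (maxn m n) => //; exact: leq_maxr.
apply: (@lim_sup_set_geometric _ _ _ _ _ 64) => i; first exact: measurableC.
have := cosp_sum_half lacunary PE (expn_gt0 2 i : (0 < 2 ^ i)%N = true).
rewrite (_ : [set x | _] = (@torus_cis R) @^-1` (~` A i)) //.
apply/seteqP; split=> x; rewrite /A /= SE ltNge.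
  by move/negP.
by move=> ?; exact/negP.
Qed.

End riesz_torus_measure.

Theorem theorem4p7 (R : realType) (w : nat -> R)
    (w_gt0 : forall n, 0 < w n)
    (w_small : exists (eps : R) (N : nat -> nat),
      [/\ 0 < eps,
          forall j, (0 < N j)%N &
          (fun j => sup [set w n | n in
             [set n : nat | `|n%:R - (N j)%:R| <= eps * (N j)%:R]])
            @ \oo --> (0 : R)]) :
  exists sigma : probability (torus R) R,
    (exists E : set (torus R),
      [/\ measurable E, torus_lebesgue E = 0%E & sigma (~` E) = 0%E]) /\
    (\esum_(n in [set: int])
       (normc (fourier_coef sigma n) ^+ 2 * w `|n|%N)%:E < +oo)%E.
Proof.
have [eps [P [eps0 _ wP]]] := w_small.
have [N [lacunary growth wN]] := frequency_choice w_gt0 eps0 wP.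
have [sigma [sigmaE sing]] := riesz_torus_probability (R := R) lacunary growth.
(* [w 0 + 2] is the bound of [riesz_sum_weight] without its negative term; it holds for every finite
   set of frequencies, hence for the supremum. *)
exists sigma; split=> //; apply: (@le_lt_trans _ _ (w 0%N + 2)%:E); last exact: ltry.
apply: ub_ereal_sup => _ [X [finX _] <-].
rewrite fsbig_finite// sumEFin lee_fin.
have := finmap.fset_uniq (fset_set X); move: (finmap.enum_fset _) => s us.
(* This [k] is at least [|n|] for all [n] in [s], so at rank [k] the coefficients on [s] have their
   final values and one partial product serves the whole sum. *)
pose k := (\sum_(n <- s) `|n|)%N.
have -> : \sum_(n <- s) normc (fourier_coef sigma n) ^+ 2 * w `|n|%N =
    \sum_(n <- s) riesz_coef N k n ^+ 2 * w `|n|%N.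
  rewrite big_seq [RHS]big_seq; apply: eq_bigr => n ns.
  have nk : (`|n| <= k)%N by rewrite /k (bigD1_seq n)//= leq_addr.
  rewrite sigmaE (riesz_coef_stable lacunary (leq_id_freq_bound lacunary _) nk).
  by rewrite /= expr0n addr0 sqr_sqrtr ?sqr_ge0.
apply: (le_trans (riesz_coef_sum lacunary k us (h := fun n => w `|n|%N) _)).
  by move=> n; exact: ltW.
apply: (le_trans (riesz_sum_weight lacunary k wN)).
by rewrite lerBlDr lerDl mulr_ge0// exprn_ge0.
Qed.
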